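(* Let $\bar{x}\in\Omega$ and suppose that (H1) and (H2) are satisfied at $\bar{x}$. Assume that for every $\psi\in\mathrm{w}\text{-}\limsup_{(x,\theta)\to(\bar{x},0)}\mathcal{M}(x,\theta)$ there exist a representing sequence $\{(x^k,\theta^k,\psi^k,u^k,v^k)\}$ of $\psi$ and constants $k_u>0$, $k_v>0$ such that $$\|u^k(t)\|\le k_u\quad\text{and}\quad\|v^k(t)\|\le k_v\quad\text{for a.e. }t\in[0,T]\text{ and all }k\in\mathbb{N}.$$ Then AKKT-regularity is satisfied at $\bar{x}$, that is, $\mathrm{w}\text{-}\limsup_{(x,\theta)\to(\bar{x},0)}\mathcal{M}(x,\theta)\subset\mathcal{M}(\bar{x},0)$.
   Context: Problem. Let $T>0$, and let $\phi:\mathbb{R}^n\times[0,T]\to\mathbb{R}$, $h=(h_1,\dots,h_p):\mathbb{R}^n\times[0,T]\to\mathbb{R}^p$, $g=(g_1,\dots,g_m):\mathbb{R}^n\times[0,T]\to\mathbb{R}^m$ be given; $I=\{1,\dots,p\}$, $J=\{1,\dots,m\}$. Problem (CTP): minimize $P(x)=\int_0^T\phi(x(t),t)\,dt$ over $x\in L^\infty([0,T];\mathbb{R}^n)$ subject to $h(x(t),t)=0$ and $g(x(t),t)\le 0$ for a.e. $t\in[0,T]$ (vector inequalities are componentwise). The feasible set is $\Omega=\{x\in L^\infty([0,T];\mathbb{R}^n): h(x(t),t)=0,\ g(x(t),t)\le 0 \text{ for a.e. } t\in[0,T]\}$. For a given $\bar{x}\in\Omega$ and $r>0$, $B_r(t)=\{x\in\mathbb{R}^n:\|x-\bar{x}(t)\|<r\}$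 and $\bar{B}_r(t)=\{x\in\mathbb{R}^n:\|x-\bar{x}(t)\|\le r\}$, for a.e. $t$. Assumptions. (H1) and (H2) are satisfied at $\bar{x}\in\Omega$ if there is $r>0$ (fixed from now on) such that: (H1) $\phi(\cdot,t)$ is continuously differentiable for a.e. $t\in[0,T]$; $\phi(x,\cdot)$ is Lebesgue measurable for each $x$; $|\phi(\bar{x}(\cdot),\cdot)|$ is integrable on $[0,T]$; there are integrable functions $c_\phi,\hat{c}_\phi$ on $[0,T]$ with $|\phi(x,t)-\phi(y,t)|\le c_\phi(t)\|x-y\|$ for all $x,y\in\bar{B}_r(t)$ and $\|\nabla_x\phi(x,t)\|\le\hat{c}_\phi(t)$ for all $x\in\bar{B}_r(t)$, for a.e. $t\in[0,T]$. (H2) $(h,g)(\cdot,t)$ is continuously differentiable for a.e. $t\in[0,T]$; $(h,g)(x,\cdot)$ is Lebesgue measurable for each $x$; $\|(h,g)(\bar{x}(\cdot),\cdot)\|$ is integrable on $[0,T]$; there are integrable functions $c_{h,g},\hat{c}_{h,g}$ on $[0,T]$ with $\|(h,g)(x,t)-(h,g)(y,t)\|\le c_{h,g}(t)\|x-y\|$ for all $x,y\in\bar{B}_r(t)$ and $\|\nabla_x(h,g)(x,t)\|\le\hat{c}_{h,g}(t)$ for all $x\in\bar{B}_r(t)$, for a.e. $t\in[0,T]$. The map $\mathcal{M}$. Let $g_j^-(x,t)=\max\{-g_j(x,t),0\}$, $E=\{x\in L^\infty([0,T];\mathbb{R}^n): x(t)\in B_r(t)\text{ a.e. }t\in[0,T]\}$,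 $F=\{\theta\in L^1([0,T];\mathbb{R}^m):\theta(t)\ge 0\text{ a.e. }t\in[0,T]\}$. For $(x,\theta)\in E\times F$, $\mathcal{M}(x,\theta)$ is the set of all $\psi\in L^1([0,T];\mathbb{R}^n)$ for which there is $(u,v)\in L^\infty([0,T];\mathbb{R}^p\times\mathbb{R}^m)$ such that, for a.e. $t\in[0,T]$, $\psi(t)=\sum_{i=1}^p u_i(t)\nabla_xh_i(x(t),t)+\sum_{j=1}^m v_j(t)\nabla_xg_j(x(t),t)$, $v_j(t)g_j^-(x(t),t)=\theta_j(t)$ and $v_j(t)\ge0$ for all $j\in J$. The weak outer limit $\mathrm{w}\text{-}\limsup_{(x,\theta)\to(\bar{x},0)}\mathcal{M}(x,\theta)$ is the set of all $\psi\in L^1([0,T];\mathbb{R}^n)$ for which there exist $\{(x^k,\theta^k)\}\subset E\times F$ with $(x^k(t),\theta^k(t))\to(\bar{x}(t),0)$ for a.e. $t\in[0,T]$ and $\psi^k\in\mathcal{M}(x^k,\theta^k)$ for all $k\in\mathbb{N}$ with $\psi^k\rightharpoonup\psi$ weakly in $L^1([0,T];\mathbb{R}^n)$. Representing sequence. By these definitions, every $\psi$ in the weak outer limit admits at least one representing sequence, i.e. a sequence $\{(x^k,\theta^k,\psi^k,u^k,v^k)\}$ with $(x^k,\theta^k)\in E\times F$, $(x^k(t),\theta^k(t))\to(\bar{x}(t),0)$ for a.e. $t$, $\psi^k\in L^1([0,T];\mathbb{R}^n)$, $\psi^k\rightharpoonup\psi$ weakly in $L^1([0,T];\mathbb{R}^n)$,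 $(u^k,v^k)\in L^\infty([0,T];\mathbb{R}^p\times\mathbb{R}^m)$ and, for every $k$ and a.e. $t\in[0,T]$, $\psi^k(t)=\sum_{i=1}^p u_i^k(t)\nabla_xh_i(x^k(t),t)+\sum_{j=1}^m v_j^k(t)\nabla_xg_j(x^k(t),t)$, $v_j^k(t)g_j^-(x^k(t),t)=\theta_j^k(t)$, $v_j^k(t)\ge0$ for all $j\in J$. *)

(* Defs.v *)
From HB Require Import structures.
From mathcomp Require Import all_boot all_order all_algebra.
From mathcomp Require Import all_classical all_reals all_analysis.
Import Order.TTheory GRing.Theory Num.Theory.
Import numFieldNormedType.Exports.

Set Implicit Arguments.
Unset Strict Implicit.
Unset Printing Implicit Defensive.

Local Open Scope classical_set_scope.
Local Open Scope ring_scope.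

(* The library norm on matrices is the sup norm; this is the Euclidean one
   (the Frobenius norm when applied to a Jacobian). *)
Definition enorm (R : realType) (a b : nat) (A : 'M[R]_(a, b)) : R :=
  Num.sqrt (\sum_(i < a) \sum_(j < b) A i j ^+ 2).

Definition gradient (R : realType) (n : nat) (f : 'rV[R]_n -> R)
    (x : 'rV[R]_n) : 'rV[R]_n :=
  \row_(i < n) 'D_(delta_mx 0 i) f x.

Definition continuously_differentiable (R : realType) (n : nat)
    (V : normedModType R) (f : 'rV[R]_n -> V) : Prop :=
  (forall x, differentiable f x) /\
  (forall i : 'I_n, continuous (fun x => 'D_(delta_mx 0 i) f x)).

(* The real line with the Lebesgue (not just Borel) sigma-algebra. The library
   equips R itself with the Borel sets, hence the type alias. *)
Definition lebesgueR (R : realType) : measurableType _ :=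
  caratheodory_type ((@wlength R idfun)^*)%mu.

Definition leb (R : realType) : {measure set (lebesgueR R) -> \bar R} :=
  @completed_lebesgue_measure R.

Section ContinuousTimeProgramming.
Context {R : realType}.
Variable T : R.

Local Notation I := ([set` `[0%R, T]] : set (lebesgueR R)).

Definition ae_time (P : R -> Prop) : Prop :=
  {ae leb R, forall t : lebesgueR R, I t -> P t}.

Definition lebesgue_measurable (f : R -> R) : Prop :=
  measurable_fun I (f : lebesgueR R -> R).

Definition lebesgue_integrable (f : R -> R) : Prop :=
  (leb R).-integrable I (fun t : lebesgueR R => (f t)%:E).

(* Elements of L^oo([0, T]; R^n) and L^1([0, T]; R^n) are represented by
   functions; values outside [0, T] are irrelevant. *)
Definition Linfty (n : nat) (x : R -> 'rV[R]_n) : Prop :=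
  (forall i : 'I_n, lebesgue_measurable (fun t => x t 0 i)) /\
  exists c : R, ae_time (fun t => enorm (x t) <= c).

Definition L1 (n : nat) (x : R -> 'rV[R]_n) : Prop :=
  forall i : 'I_n, lebesgue_integrable (fun t => x t 0 i).

(* Continuous linear functionals on L^1. Boundedness forces them to identify
   functions that agree a.e. on [0, T]. *)
Definition L1_dual (n : nat) (L : (R -> 'rV[R]_n) -> R) : Prop :=
  (forall (a : R) (f g : R -> 'rV[R]_n), L1 f -> L1 g ->
     L (fun t => a *: f t + g t) = a * L f + L g) /\
  exists c : R, forall f : R -> 'rV[R]_n, L1 f ->
    `|L f| <= c * Rintegral (leb R) I (fun t => enorm (f t)).

Definition L1_weak_cvg (n : nat) (f_ : nat -> R -> 'rV[R]_n)
    (f : R -> 'rV[R]_n) : Prop :=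
  forall L : (R -> 'rV[R]_n) -> R, L1_dual L -> L (f_ k) @[k --> \oo] --> L f.

Variables n p m : nat.
Variable phi : 'rV[R]_n -> R -> R.
Variable h : 'rV[R]_n -> R -> 'rV[R]_p.
Variable g : 'rV[R]_n -> R -> 'rV[R]_m.

Definition feasible : set (R -> 'rV[R]_n) :=
  [set x | Linfty x /\
    ae_time (fun t => h (x t) t = 0 /\ forall j : 'I_m, g (x t) t 0 j <= 0)].

Definition hg (x : 'rV[R]_n) (t : R) : 'rV[R]_(p + m) :=
  row_mx (h x t) (g x t).

Definition tube (xbar : R -> 'rV[R]_n) (r t : R) : set 'rV[R]_n :=
  [set x | enorm (x - xbar t) < r].

Definition closed_tube (xbar : R -> 'rV[R]_n) (r t : R) : set 'rV[R]_n :=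
  [set x | enorm (x - xbar t) <= r].

Definition H1 (xbar : R -> 'rV[R]_n) (r : R) : Prop :=
  [/\ ae_time (fun t => continuously_differentiable (phi^~ t)),
      forall x, lebesgue_measurable (phi x),
      lebesgue_integrable (fun t => `|phi (xbar t) t|) &
      exists c c' : R -> R,
        [/\ lebesgue_integrable c, lebesgue_integrable c' &
          ae_time (fun t =>
            (forall x y, closed_tube xbar r t x -> closed_tube xbar r t y ->
               `|phi x t - phi y t| <= c t * enorm (x - y)) /\
            (forall x, closed_tube xbar r t x ->
               enorm (gradient (phi^~ t) x) <= c' t))]].

Definition H2 (xbar : R -> 'rV[R]_n) (r : R) : Prop :=
  [/\ ae_time (fun t => continuously_differentiable (hg^~ t)),
      forall x (l : 'I_(p + m)), lebesgue_measurable (fun t => hg x t 0 l),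
      lebesgue_integrable (fun t => enorm (hg (xbar t) t)) &
      exists c c' : R -> R,
        [/\ lebesgue_integrable c, lebesgue_integrable c' &
          ae_time (fun t =>
            (forall x y, closed_tube xbar r t x -> closed_tube xbar r t y ->
               enorm (hg x t - hg y t) <= c t * enorm (x - y)) /\
            (forall x, closed_tube xbar r t x ->
               enorm ('J (hg^~ t) x) <= c' t))]].

Definition gminus (j : 'I_m) (x : 'rV[R]_n) (t : R) : R :=
  Num.max (- g x t 0 j) 0.

Definition Eset (xbar : R -> 'rV[R]_n) (r : R) : set (R -> 'rV[R]_n) :=
  [set x | Linfty x /\ ae_time (fun t => tube xbar r t (x t))].

Definition Fset : set (R -> 'rV[R]_m) :=
  [set theta | L1 theta /\ ae_time (fun t => forall j : 'I_m, 0 <= theta t 0 j)].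

Definition multiplier_system (x : R -> 'rV[R]_n) (theta : R -> 'rV[R]_m)
    (psi : R -> 'rV[R]_n) (u : R -> 'rV[R]_p) (v : R -> 'rV[R]_m) : Prop :=
  ae_time (fun t =>
    psi t = \sum_(i < p) u t 0 i *: gradient (fun y => h y t 0 i) (x t)
          + \sum_(j < m) v t 0 j *: gradient (fun y => g y t 0 j) (x t) /\
    forall j : 'I_m, v t 0 j * gminus j (x t) t = theta t 0 j /\ 0 <= v t 0 j).

(* Its values are only used for x in [Eset] and theta in [Fset]. *)
Definition Mmap (x : R -> 'rV[R]_n) (theta : R -> 'rV[R]_m) :
    set (R -> 'rV[R]_n) :=
  [set psi | L1 psi /\
    exists (u : R -> 'rV[R]_p) (v : R -> 'rV[R]_m),
      [/\ Linfty u, Linfty v & multiplier_system x theta psi u v]].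

Definition approaching (xbar : R -> 'rV[R]_n) (r : R)
    (x : nat -> R -> 'rV[R]_n) (theta : nat -> R -> 'rV[R]_m) : Prop :=
  (forall k, Eset xbar r (x k) /\ Fset (theta k)) /\
  ae_time (fun t => x k t @[k --> \oo] --> xbar t /\
                    theta k t @[k --> \oo] --> (0 : 'rV[R]_m)).

Definition weak_outer_limit (xbar : R -> 'rV[R]_n) (r : R) :
    set (R -> 'rV[R]_n) :=
  [set psi | L1 psi /\
    exists (x : nat -> R -> 'rV[R]_n) (theta : nat -> R -> 'rV[R]_m)
           (psi_ : nat -> R -> 'rV[R]_n),
      [/\ approaching xbar r x theta,
          forall k, Mmap (x k) (theta k) (psi_ k) &
          L1_weak_cvg psi_ psi]].

Definition representing_sequence (xbar : R -> 'rV[R]_n) (r : R)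
    (psi : R -> 'rV[R]_n)
    (x : nat -> R -> 'rV[R]_n) (theta : nat -> R -> 'rV[R]_m)
    (psi_ : nat -> R -> 'rV[R]_n)
    (u : nat -> R -> 'rV[R]_p) (v : nat -> R -> 'rV[R]_m) : Prop :=
  [/\ approaching xbar r x theta,
      (forall k, L1 (psi_ k)) /\ L1_weak_cvg psi_ psi,
      forall k, Linfty (u k) /\ Linfty (v k) &
      forall k, multiplier_system (x k) (theta k) (psi_ k) (u k) (v k)].

Definition AKKT_regular (xbar : R -> 'rV[R]_n) (r : R) : Prop :=
  weak_outer_limit xbar r `<=` Mmap xbar (fun=> 0).

End ContinuousTimeProgramming.

(* Main.v *)
Require Import Defs.
From mathcomp Require Import all_boot all_order all_algebra.
From mathcomp Require Import all_classical all_reals all_analysis.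
From mathcomp Require Import measurable_realfun ring lra.
Import Order.TTheory GRing.Theory Num.Theory.
Import numFieldNormedType.Exports.

Set Implicit Arguments.
Unset Strict Implicit.
Unset Printing Implicit Defensive.

Local Open Scope classical_set_scope.
Local Open Scope ring_scope.

(** Why the theorem holds.

    Let psi be a weak limit of psi_k = w_k * A_k, where w_k = (u_k, v_k) is
    the uniformly bounded multiplier and A_k(t) is the transposed Jacobian of
    (h, g) at x_k(t), which converges for a.e. t to its value A(t) at xbar(t).
    The multipliers need not converge at any t. Therefore w_k and psi_k are
    averaged simultaneously, with the same weights, so that the averaged
    multipliers do converge a.e.

    The averages are iterated midpoints of elements of a tail of the sequence
    of pairs (w_k, psi_k) ([tail_hull]). Among them, pairs whose multiplier
    nearly minimizes the squared L^2 norm are close to each other by the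
    parallelogram identity ([tail_hull_near_minimizers]); this yields averages
    y_k, with y_k taken from the k-th tail, whose multipliers converge
    a.e. to some W = (u, v) ([bounded_tail_hull_ae_cvg]).

    Every convergence that is expressed by an affine functional of the pair
    survives averaging over tails ([tail_hull_cvg]), and three functionals are
    enough:
    - continuous functionals on L^1: the averaged psi_k still converge weakly
      to psi;
    - for fixed t, the coordinates of psi_k - w_k * A, which tend to 0 because
      A_k tends to A and w_k is bounded: hence the averaged psi_k converge
      a.e. to W * A ([tail_hull_mulmx_cvg]);
    - for fixed t, v_kj * gminus_j(xbar), which tends to 0 because theta_k
      does: hence v_j * gminus_j(xbar) = 0 ([complementarity_limit]).

    The Jacobian bound of (H2) dominates the averaged psi_k by an integrable
    function, so their weak limit psi and their a.e. limit W * A have the same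
    integral over every measurable set and agree a.e.
    ([weak_limit_ae_limit]). Thus (u, v) are multipliers for psi at
    (xbar, 0). *)

(** * Averages over the tails of a sequence *)

(** The convex combinations with dyadic weights of the terms of index at least
    [N]. Generating them by midpoints alone makes every property stable under
    midpoints follow by a two-case induction. *)
Inductive tail_hull {R : realType} {V : lmodType R} (w : nat -> V) (N : nat) :
    V -> Prop :=
| tail_hull_base k : (N <= k)%N -> tail_hull w N (w k)
| tail_hull_mid x y : tail_hull w N x -> tail_hull w N y ->
    tail_hull w N (2^-1 *: (x + y)).

Lemma tail_hullW {R : realType} {V : lmodType R} (w : nat -> V) (M N : nat)
    (x : V) :
  (N <= M)%N -> tail_hull w M x -> tail_hull w N x.
Proof.
move=> NM; elim=> [k Mk|? ? _ ? _ ?]; last exact: tail_hull_mid.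
exact/tail_hull_base/(leq_trans NM).
Qed.

(** Used with evaluation at a time [t], to pass from averages of functions to
    averages of their values. *)
Lemma tail_hull_image {R : realType} {V V' : lmodType R} (f : V -> V')
    (w : nat -> V) N x :
  (forall y z, f (2^-1 *: (y + z)) = 2^-1 *: (f y + f z)) ->
  tail_hull w N x -> tail_hull (f \o w) N (f x).
Proof.
move=> fmid; elim=> [k Nk|y z _ hy _ hz].
  exact: (@tail_hull_base _ _ (f \o w)).
by rewrite fmid; exact: tail_hull_mid.
Qed.

(** The condition that [l] is within [e] of [a] is stable under midpoints, so
    it holds on the whole hull of a tail as soon as it holds on that tail.
    Affinity is only asked on the hull because functionals on L^1 are linear
    on integrable functions only. *)
Lemma tail_hull_cvg {R : realType} {V : lmodType R} (w y : nat -> V)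
    (l : V -> R) (a : R) :
  (forall k, tail_hull w k (y k)) ->
  (forall x z, tail_hull w 0 x -> tail_hull w 0 z ->
     l (2^-1 *: (x + z)) = 2^-1 * (l x + l z)) ->
  l (w k) @[k --> \oo] --> a -> l (y k) @[k --> \oo] --> a.
Proof.
move=> hy lmid /cvgrPdist_le wa; apply/cvgrPdist_le => e e0.
have [N _ Nwa] := wa e e0.
exists N => // k /= Nk.
elim: (tail_hullW Nk (hy k)) => [j Nj|x z hx IHx hz IHz]; first exact: Nwa.
rewrite lmid; [|exact: tail_hullW hx|exact: tail_hullW hz].
move: IHx IHz; rewrite !ler_norml; lra.
Qed.

(** This is the projection argument of Hilbert spaces. The infima of [q] on
    the hulls of the successive tails increase to a number [s]. If [x] and [z]
    lie in a hull on which [q > s - e], and [q x, q z < s + e], then so does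
    their midpoint, and the parallelogram identity leaves [q (x - z) < 8 e].
    The seminorm [q] is abstract so that it can ignore one component of [V]:
    that component is averaged along without being controlled. *)
Lemma tail_hull_near_minimizers {R : realType} {V : lmodType R}
    (w : nat -> V) (q : V -> R) (B : R) (eps : nat -> R) :
  (forall k, 0 < eps k) ->
  (forall x, tail_hull w 0 x -> 0 <= q x <= B) ->
  (forall x z, tail_hull w 0 x -> tail_hull w 0 z ->
     q (x - z) + 4 * q (2^-1 *: (x + z)) = 2 * (q x + q z)) ->
  exists y : nat -> V, (forall k, tail_hull w k (y k)) /\
    forall k, q (y k.+1 - y k) <= eps k + eps k.+1.
Proof.
move=> eps0 qB parallelogram.
pose values N := [set q x | x in tail_hull w N].
have valuesP N : has_inf (values N).
  split; first by exists (q (w N)); exists (w N) => //; exact: tail_hull_base.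
  by exists 0 => _ [x hx <-]; case/andP: (qB _ (tail_hullW (leq0n N) hx)).
pose mins := [set inf (values N) | N in [set: nat]].
have mins_sup : has_sup mins.
  split; first by exists (inf (values 0%N)), 0%N.
  exists B => _ [N _ <-]; apply: (@le_trans _ _ (q (w N))).
    apply: (ge_inf (proj2 (valuesP N))).
    by exists (w N) => //; exact: tail_hull_base.
  by have /andP[] := qB (w N) (tail_hull_base w (leq0n N)).
(* With the margin [eps k / 6] the estimate of the lemma comes out exactly:
   [2 * 2 * (e / 6) + 4 * (2 * e / 6) = 2 * e] when both margins are [e / 6]. *)
have level k : exists N, forall x, tail_hull w N x ->
    sup mins - eps k / 6 < q x.
  have [|_ [N _ <-] ltN] := sup_adherent _ mins_sup (eps := eps k / 6).
    by rewrite divr_gt0.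
  exists N => x hx; apply: (lt_le_trans ltN).
  by apply: (ge_inf (proj2 (valuesP N))); exists x.
have [M Mlow] := choice level.
have almost_min k : exists x, tail_hull w (maxn k (M k)) x /\
    q x < sup mins + eps k / 6.
  have [|_ [x hx <-] ltx] := inf_adherent (eps := eps k / 6) _
      (valuesP (maxn k (M k))).
    by rewrite divr_gt0.
  exists x; split=> //; apply: (lt_le_trans ltx); rewrite lerD2r.
  by apply: (ub_le_sup (proj2 mins_sup)); exists (maxn k (M k)).
have [y yP] := choice almost_min.
exists y; split=> k; first exact: tail_hullW (leq_maxl _ _) (yP k).1.
have [hk lek] := yP k; have [hk1 lek1] := yP k.+1.
have hull0 N x : tail_hull w N x -> tail_hull w 0 x by exact: tail_hullW.
(* The midpoint lies in the larger of the two hulls [M k] and [M k.+1], and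
   nothing tells which one that is; both errors are therefore allowed. *)
have := parallelogram _ _ (hull0 _ _ hk1) (hull0 _ _ hk).
have : sup mins - (eps k / 6 + eps k.+1 / 6) < q (2^-1 *: (y k.+1 + y k)).
  have e1 := eps0 k; have e2 := eps0 k.+1.
  have [le|/ltnW le] := leqP (M k) (M k.+1).
    apply: (@lt_trans _ _ (sup mins - eps k / 6)); first lra.
    apply: Mlow; apply: tail_hull_mid.
      by apply: tail_hullW hk1; rewrite (leq_trans le)// leq_maxr.
    by apply: tail_hullW hk; rewrite leq_maxr.
  apply: (@lt_trans _ _ (sup mins - eps k.+1 / 6)); first lra.
  apply: Mlow; apply: tail_hull_mid.
    by apply: tail_hullW hk1; rewrite leq_maxr.
  by apply: tail_hullW hk; rewrite (leq_trans le)// leq_maxr.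
lra.
Qed.

(** * Averages that converge almost everywhere *)

Lemma is_cvg_geometric_increments (R : realType) (a : nat -> R) (M : R) :
  (forall k, `|a k.+1 - a k| <= M * 2^-1 ^+ k) -> cvgn a.
Proof.
move=> aM.
have -> : a = (fun=> a 0%N) + series (telescope a).
  by apply/funext => k; rewrite {1}(eq_sum_telescope a k).
apply: is_cvgD; first exact: is_cvg_cst.
apply: normed_cvg; apply: (@series_le_cvg _ _ (geometric M 2^-1)).
- by move=> n; exact: normr_ge0.
- by move=> n; exact: le_trans (normr_ge0 _) (aM n).
- exact: aM.
- by apply: is_cvg_geometric_series; rewrite ger0_norm ?invr_ge0// invf_lt1// ltr1n.
Qed.

(** The series of the [4 ^ k |y_{k+1} - y_k| ^ 2] has a finite integral, hence
    a finite sum almost everywhere, and there the increments are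
    [O (2 ^ - k)]. *)
Lemma ae_cvg_square_increments d (T : measurableType d) (R : realType)
    (mu : {measure set T -> \bar R}) (D : set T) (y : nat -> T -> R) (C : R) :
  measurable D -> (forall k, measurable_fun D (y k)) ->
  (forall k, \int[mu]_(t in D) ((y k.+1 t - y k t) ^+ 2)%:E
     <= (C * 8^-1 ^+ k)%:E)%E ->
  \forall t \ae mu, D t -> cvgn (y ^~ t).
Proof.
move=> mD my yC.
pose f k t : \bar R := (4 ^+ k * (y k.+1 t - y k t) ^+ 2)%:E.
have mf k : measurable_fun D (f k).
  apply/measurable_EFinP; apply: measurable_funM => //.
  by apply/measurable_funX/measurable_funB.
have f0 k t : D t -> (0 <= f k t)%E.
  by move=> _; rewrite lee_fin mulr_ge0 ?sqr_ge0 ?exprn_ge0.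
have fsum : (\int[mu]_(t in D) (\sum_(k <oo) f k t) < +oo)%E.
  rewrite integral_nneseries//.
  apply: (@le_lt_trans _ _ (\sum_(k <oo) (geometric C 2^-1 k)%:E)%E).
    apply: lee_nneseries => [k _ _|k _].
      by apply: integral_ge0 => t Dt; exact: f0.
    rewrite /f; under eq_integral do rewrite EFinM.
    rewrite ge0_integralZl_EFin//; last 2 first.
    - by move=> t _; rewrite lee_fin sqr_ge0.
    - by apply/measurable_EFinP/measurable_funX/measurable_funB.
    apply: (@le_trans _ _ ((4 ^+ k)%:E * (C * 8^-1 ^+ k)%:E)%E).
      by rewrite lee_pmul2l// lte_fin exprn_gt0.
    rewrite -EFinM lee_fin /= le_eqVlt; apply/orP; left; apply/eqP.
    by rewrite mulrCA -exprMn; congr (_ * _ ^+ _); field.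
  have C0 : 0 <= C.
    have := yC 0%N; rewrite expr0 mulr1 -lee_fin; apply: le_trans.
    by apply: integral_ge0 => t _; rewrite lee_fin sqr_ge0.
  apply: (@le_lt_trans _ _ (C * (1 - 2^-1)^-1)%:E)%E; last exact: ltry.
  apply: lime_le.
    apply: is_cvg_nneseries => k _ _.
    by rewrite lee_fin mulr_ge0// exprn_ge0// invr_ge0.
  apply: nearW => k; rewrite sumEFin lee_fin; apply: geometric_le_lim => //.
  by rewrite ger0_norm ?invr_ge0// invf_lt1// ltr1n.
have mF : measurable_fun D (fun t => \sum_(k <oo) f k t)%E.
  by apply: (@ge0_emeasurable_sum _ _ _ D f xpredT) => [k t Dt _|k _];
    [exact: f0|exact: mf].
have iF : mu.-integrable D (fun t => \sum_(k <oo) f k t)%E.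
  apply/integrableP; split=> //.
  under eq_integral => t /set_mem Dt.
    rewrite gee0_abs; last by apply: nneseries_ge0 => k _ _; exact: f0.
    over.
  by [].
move: (integrable_ae mD iF); apply: filterS => t Ft Dt.
have /fineK Mdef := Ft Dt; set M := fine _ in Mdef.
have fM k : 4 ^+ k * (y k.+1 t - y k t) ^+ 2 <= M.
  rewrite -lee_fin Mdef; apply: le_trans (nneseries_lim_ge k.+1 _); last first.
    by move=> i _ _; exact: f0.
  rewrite big_nat_recr//= leeDr//; apply: sume_ge0 => i _; exact: f0.
have M0 : 0 <= M.
  by apply: le_trans (fM 0%N); rewrite mulr_ge0 ?sqr_ge0 ?exprn_ge0.
apply: (@is_cvg_geometric_increments _ _ (1 + M)) => k.
rewrite -(@ler_pXn2r _ 2) ?nnegrE//; last by rewrite mulr_ge0 ?addr_ge0.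
have p4 : 4 ^+ k = (2 ^+ k) ^+ 2 :> R by rewrite exprAC; congr (_ ^+ _); ring.
have p2 : 0 < 2 ^+ k :> R by rewrite exprn_gt0.
rewrite exprMn exprVn -normrX ger0_norm ?sqr_ge0// exprVn.
rewrite ler_pdivlMr ?exprn_gt0// -p4 mulrC (le_trans (fM k))//.
by rewrite sqrrD; nra.
Qed.

(** The upper limit of the sequence is measurable and equals [f] a.e., which
    is enough for a complete measure. *)
Lemma ae_limit_measurable d (T : measurableType d) (R : realType)
    (mu : {measure set T -> \bar R}) (D : set T) (f_ : nat -> T -> R)
    (f : T -> R) :
  measure_is_complete mu -> (forall k, measurable_fun D (f_ k)) ->
  (\forall t \ae mu, D t -> f_ ^~ t @ \oo --> f t) -> measurable_fun D f.
Proof.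
move=> cmu mf_ f_f; apply/measurable_EFinP.
apply: (@ae_measurable_fun _ _ _ _ cmu _
         (fun t => limn_esup (fun k => (f_ k t)%:E))); last first.
  by apply: measurable_fun_limn_esup => k; apply/measurable_EFinP.
apply: filterS f_f => t ft Dt /=.
rewrite is_cvg_limn_esupE.
  by apply/cvg_lim => //; apply/fine_cvgP; split; [exact: nearW|exact: ft].
by apply/cvg_ex; exists (f t)%:E; apply/fine_cvgP; split; [exact: nearW|exact: ft].
Qed.

Lemma bounded_square_integrable d (T : measurableType d) (R : realType)
    (mu : {measure set T -> \bar R}) (D : set T) (f : T -> R) (M : R) :
  measurable D -> (mu D < +oo)%E -> measurable_fun D f ->
  (\forall t \ae mu, D t -> `|f t| <= M) ->
  mu.-integrable D (EFin \o (fun t => f t ^+ 2)) /\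
  \int[mu]_(t in D) (f t ^+ 2) <= M ^+ 2 * fine (mu D).
Proof.
move=> mD Dfin mf fM.
have mf2 : measurable_fun D (fun t => (f t ^+ 2)%:E).
  by apply/measurable_EFinP/measurable_funX.
have bound : (\int[mu]_(t in D) `|(f t ^+ 2)%:E| <= (M ^+ 2)%:E * mu D)%E.
  apply: integral_le_bound => //; first by rewrite lee_fin sqr_ge0.
  apply: filterS fM => t fM Dt; rewrite lee_fin ger0_norm ?sqr_ge0//.
  rewrite -[f t ^+ 2]ger0_norm ?sqr_ge0// normrX; have := fM Dt.
  by have := normr_ge0 (f t); nra.
have finM : ((M ^+ 2)%:E * mu D)%E \is a fin_num.
  by rewrite fin_numM// ge0_fin_numE.
have i2 : mu.-integrable D (EFin \o (fun t => f t ^+ 2)).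
  apply/integrableP; split=> //; apply: le_lt_trans bound _.
  by rewrite -ge0_fin_numE// mule_ge0 ?lee_fin ?sqr_ge0.
split=> //; rewrite -lee_fin EFinM !fineK//.
- apply: le_trans bound; rewrite le_eqVlt; apply/orP; left; apply/eqP.
  by apply: eq_integral => t _; rewrite gee0_abs// lee_fin sqr_ge0.
- by rewrite ge0_fin_numE.
- exact: (integrable_fin_num mD i2).
Qed.

(** A form of the Komlos-Mazur principle: a bounded sequence has averages over
    its tails that converge a.e. The component in [Z] is carried along so that
    the same weights also act on a companion sequence. *)
Lemma bounded_tail_hull_ae_cvg d (T : measurableType d) (R : realType)
    (mu : {measure set T -> \bar R}) (D : set T) (n : nat) (Z : lmodType R)
    (w : nat -> (T -> 'rV[R]_n) * Z) (C : R) :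
  measurable D -> (mu D < +oo)%E ->
  (forall k i, measurable_fun D (fun t => (w k).1 t 0 i)) ->
  (forall k, \forall t \ae mu, D t -> forall i, `|(w k).1 t 0 i| <= C) ->
  exists y : nat -> (T -> 'rV[R]_n) * Z,
    [/\ forall k, tail_hull w k (y k),
        forall k i, measurable_fun D (fun t => (y k).1 t 0 i) &
        \forall t \ae mu, D t -> forall i, cvgn (fun k => (y k).1 t 0 i)].
Proof.
move=> mD Dfin mw wC.
pose good (x : (T -> 'rV[R]_n) * Z) :=
  (forall i, measurable_fun D (fun t => x.1 t 0 i)) /\
  (\forall t \ae mu, D t -> forall i, `|x.1 t 0 i| <= C).
have hull_good N x : tail_hull w N x -> good x.
  elim=> [k _|{}x z _ [mx xC] _ [mz zC]]; first by split=> // i; exact: mw.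
  split=> [i|].
    apply: (eq_measurable_fun (fun t => 2^-1 * (x.1 t 0 i + z.1 t 0 i))).
      by move=> t _; rewrite !mxE.
    by apply: measurable_funM => //; exact: measurable_funD.
  apply: filterS2 xC zC => t xC zC Dt i; rewrite !mxE.
  by move: (xC Dt i) (zC Dt i); rewrite !ler_norml; lra.
pose q (x : (T -> 'rV[R]_n) * Z) :=
  \sum_(i < n) \int[mu]_(t in D) (x.1 t 0 i ^+ 2).
have good_coord x i M : good x -> C <= M ->
    \forall t \ae mu, D t -> `|x.1 t 0 i| <= M.
  by move=> [_ xC] CM; apply: filterS xC => t xC Dt; exact: le_trans (xC Dt i) CM.
have int_sqr x i : good x -> mu.-integrable D (EFin \o (fun t => x.1 t 0 i ^+ 2)).
  move=> gx; have [mx _] := gx.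
  by have [] := bounded_square_integrable mD Dfin (mx i) (good_coord _ i _ gx (lexx C)).
have int_sqrB x z i : good x -> good z ->
    mu.-integrable D (EFin \o (fun t => (x.1 t 0 i - z.1 t 0 i) ^+ 2)).
  move=> [mx xC] [mz zC].
  have mxz : measurable_fun D (fun t => x.1 t 0 i - z.1 t 0 i).
    exact: measurable_funB.
  have [|//] := @bounded_square_integrable _ _ _ _ _ _ (2 * C) mD Dfin mxz.
  apply: filterS2 xC zC => t xC zC Dt.
  by move: (xC Dt i) (zC Dt i); rewrite !ler_norml; lra.
have qB x z : q (x - z) =
    \sum_(i < n) \int[mu]_(t in D) ((x.1 t 0 i - z.1 t 0 i) ^+ 2).
  by apply: eq_bigr => i _; apply: eq_Rintegral => t _; rewrite !mxE.
(* Squared distances of order [8 ^ - k] leave room for the factor [4 ^ k] that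
   the almost everywhere convergence costs. *)
have [|x hx|x z hx hz|y [yh qy]] := @tail_hull_near_minimizers _ _ w q
    (\sum_(i < n) C ^+ 2 * fine (mu D)) (fun k => 8^-1 ^+ k).
- by move=> k; rewrite exprn_gt0// invr_gt0.
- have gx := hull_good _ _ hx; apply/andP; split.
    by apply: sumr_ge0 => i _; apply: Rintegral_ge0 => t _; rewrite sqr_ge0.
  apply: ler_sum => i _.
  by have [] := bounded_square_integrable mD Dfin (gx.1 i) (good_coord _ i _ gx (lexx C)).
- have gx := hull_good _ _ hx; have gz := hull_good _ _ hz.
  have gm := hull_good _ _ (tail_hull_mid hx hz).
  rewrite qB /q mulr_sumr -!big_split/= mulr_sumr; apply: eq_bigr => i _.
  rewrite -(RintegralD mD (int_sqr _ i gx) (int_sqr _ i gz)).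
  rewrite -(RintegralZl 4 mD (int_sqr _ i gm)).
  rewrite -(RintegralZl 2 mD (integrableD mD (int_sqr _ i gx) (int_sqr _ i gz))).
  rewrite -(RintegralD mD (int_sqrB _ _ i gx gz)
                          (integrableZl mD 4 (int_sqr _ i gm))).
  by apply: eq_Rintegral => t _ /=; rewrite !mxE; field.
exists y; split=> //; first by move=> k; exact: (hull_good _ _ (yh k)).1.
have cvg_coord i : \forall t \ae mu, D t -> cvgn (fun k => (y k).1 t 0 i).
  have gy k := hull_good _ _ (yh k).
  apply: (@ae_cvg_square_increments _ _ _ _ _ _ 2) => // [k|k].
    exact: (gy k).1.
  rewrite -[leLHS]fineK ?lee_fin; last first.
    exact: (integrable_fin_num mD (int_sqrB _ _ i (gy k.+1) (gy k))).
  apply: le_trans (le_trans (qy k) _); last first.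
    have : 0 <= 8^-1 ^+ k :> R by rewrite exprn_ge0 ?invr_ge0.
    by rewrite exprS; lra.
  rewrite qB (bigD1 i)//= -[leLHS]addr0 lerD//.
  by apply: sumr_ge0 => j _; apply: Rintegral_ge0 => t _; rewrite sqr_ge0.
have : \forall t \ae mu, forall i, D t -> cvgn (fun k => (y k).1 t 0 i).
  exact: filter_forall.
by apply: filterS => t yt Dt i; exact: yt.
Qed.

(** * Lebesgue measure, the Euclidean norm and weak limits in L^1 *)

Lemma leb_complete (R : realType) : measure_is_complete (leb R).
Proof. exact: measure_is_complete_caratheodory. Qed.

Lemma measurable_segment (R : realType) (a b : R) :
  measurable ([set` `[a, b]] : set (lebesgueR R)).
Proof. by apply: sub_caratheodory; exact: measurable_itv. Qed.

Lemma leb_segment_lty (R : realType) (a b : R) :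
  (leb R ([set` `[a, b]] : set (lebesgueR R)) < +oo)%E.
Proof.
have -> : leb R ([set` `[a, b]] : set (lebesgueR R)) = lebesgue_measure `[a, b].
  by [].
rewrite lebesgue_measure_itv/=; case: ifP => _; exact: ltry.
Qed.

Lemma coord_le_enorm (R : realType) (a b : nat) (A : 'M[R]_(a, b)) i j :
  `|A i j| <= enorm A.
Proof.
rewrite -sqrtr_sqr ler_wsqrtr// (bigD1 i)//= (bigD1 j)//= -addrA lerDl.
rewrite addr_ge0 ?sumr_ge0// => *; rewrite ?sumr_ge0// => *; exact: sqr_ge0.
Qed.

Lemma enorm_le_sum_coord (R : realType) (n : nat) (x : 'rV[R]_n) :
  enorm x <= \sum_(j < n) `|x 0 j|.
Proof.
have s0 : 0 <= \sum_(j < n) `|x 0 j| by apply: sumr_ge0.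
rewrite /enorm big_ord1 -(ger0_norm s0) -sqrtr_sqr ler_wsqrtr//.
elim: n x {s0} => [|n IHn] x; first by rewrite !big_ord0 expr0n.
rewrite !big_ord_recl.
have := IHn (\row_j x 0 (lift ord0 j)).
under eq_bigr do rewrite mxE; under [X in _ <= X ^+ 2 -> _]eq_bigr do rewrite mxE.
move=> IH; rewrite -[x 0 ord0 ^+ 2]ger0_norm ?sqr_ge0// normrX sqrrD -addrA lerD2l.
apply: (le_trans IH); rewrite lerDr mulrn_wge0// mulr_ge0// sumr_ge0//.
Qed.

Lemma ae_timeS (R : realType) (T : R) (P Q : R -> Prop) :
  (forall t, P t -> Q t) -> ae_time T P -> ae_time T Q.
Proof. by rewrite /ae_time => PQ; apply: filterS => t Pt It; exact/PQ/Pt. Qed.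

Lemma ae_timeI (R : realType) (T : R) (P Q : R -> Prop) :
  ae_time T P -> ae_time T Q -> ae_time T (fun t => P t /\ Q t).
Proof. by rewrite /ae_time; apply: filterS2 => t Pt Qt It; split; [exact: Pt|exact: Qt]. Qed.

Lemma ae_time_foralln (R : realType) (T : R) (P : nat -> R -> Prop) :
  (forall k, ae_time T (P k)) -> ae_time T (fun t => forall k, P k t).
Proof.
move=> aeP; have : \forall t \ae leb R, forall k : nat,
    ([set` `[0, T]] : set (lebesgueR R)) t -> P k t by exact: ae_foralln.
by apply: filterS => t Pt It k; exact: Pt.
Qed.

Lemma Linfty_of_coords (R : realType) (T : R) (n : nat) (f : R -> 'rV[R]_n) (C : R) :
  (forall i, lebesgue_measurable T (fun t => f t 0 i)) ->
  ae_time T (fun t => forall i, `|f t 0 i| <= C) -> Linfty T f.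
Proof.
move=> mf fC; split=> //; exists (\sum_(i < n) C).
apply: ae_timeS fC => t fC; apply: le_trans (enorm_le_sum_coord _) _.
by apply: ler_sum => i _; exact: fC.
Qed.

Section weak_convergence.
Context {R : realType}.
Variable T : R.
Local Notation I := ([set` `[0%R, T]] : set (lebesgueR R)).

Lemma integrable_enorm (n : nat) (f : R -> 'rV[R]_n) :
  L1 T f -> lebesgue_integrable T (fun t => enorm (f t)).
Proof.
move=> If; have mI : measurable I := measurable_segment 0 T.
have mf i : measurable_fun I (fun t : lebesgueR R => f t 0 i).
  exact/measurable_EFinP/(measurable_int _ (If i)).
have isum : (leb R).-integrable I
    (EFin \o (fun t : lebesgueR R => \sum_(i < n) `|f t 0 i|)).
  apply: (eq_integrable mI
    (fun t : lebesgueR R => \sum_(i < n) (`|f t 0 i|)%:E)%E).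
    by move=> t _; rewrite /= sumEFin.
  by apply: integrable_sum => // i _; exact: (integrable_norm (If i)).
apply: (le_integrable mI) isum.
  apply/measurable_EFinP.
  apply: (measurableT_comp (f := @Num.sqrt R)).
    apply: continuous_measurable_fun; exact: sqrt_continuous.
  apply: (eq_measurable_fun (fun t : lebesgueR R => \sum_(i < n) f t 0 i ^+ 2)).
    by move=> t _; rewrite big_ord1.
  by apply: measurable_sum => i; exact: measurable_funX.
move=> t _; rewrite lee_fin !ger0_norm ?sqrtr_ge0 ?sumr_ge0//.
exact: enorm_le_sum_coord.
Qed.

(** These functionals are all that is needed to identify a weak limit in
    L^1. *)
Lemma L1_dual_coord_integral (n : nat) (i : 'I_n) (E : set (lebesgueR R)) :
  measurable E -> E `<=` I ->
  L1_dual T (fun f : R -> 'rV[R]_n =>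
    Rintegral (leb R) E (fun t => f t 0 i)).
Proof.
move=> mE EI; have mI : measurable I := measurable_segment 0 T.
have L1E (f : R -> 'rV[R]_n) : L1 T f ->
    (leb R).-integrable E (fun t : lebesgueR R => (f t 0 i)%:E).
  by move=> /(_ i); exact: integrableS.
split=> [a f g If Ig|].
  rewrite -RintegralZl//; last exact: L1E.
  rewrite -RintegralD//; last 2 first.
  - exact: (integrableZl mE a (L1E _ If)).
  - exact: L1E.
  by apply: eq_Rintegral => t _; rewrite !mxE.
exists 1 => f If; rewrite mul1r.
apply: (le_trans (le_normr_Rintegral mE (L1E _ If))).
have iN : (leb R).-integrable I (EFin \o (fun t : lebesgueR R => `|f t 0 i|)).
  exact: (integrable_norm (If i)).
apply: (@le_trans _ _ (Rintegral (leb R) I (fun t => `|f t 0 i|))); last first.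
  apply: le_Rintegral => //; first exact: integrable_enorm.
  by move=> t _; exact: coord_le_enorm.
rewrite /Rintegral fine_le//.
- by apply: (integrable_fin_num mE); exact: integrableS iN.
- exact: (integrable_fin_num mI iN).
- apply: (ge0_subset_integral _ mE mI (measurable_int _ iN) _ EI) => t _.
  exact: normr_ge0.
Qed.

(** Dominated convergence gives the integral of [chi] over each measurable set
    as the limit of those of [f_ k]; weak convergence gives that of [f]. Two
    functions with the same integrals are equal a.e. *)
Lemma weak_limit_ae_limit (n : nat) (f_ : nat -> R -> 'rV[R]_n)
    (f chi : R -> 'rV[R]_n) (G : R -> R) :
  (forall k, L1 T (f_ k)) -> L1 T f -> L1_weak_cvg T f_ f ->
  lebesgue_integrable T G ->
  ae_time T (fun t => forall k i, `|f_ k t 0 i| <= G t) ->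
  ae_time T (fun t => forall i, f_ k t 0 i @[k --> \oo] --> chi t 0 i) ->
  ae_time T (fun t => f t = chi t).
Proof.
rewrite /ae_time => If_ If f_f IG f_G f_chi.
have mI : measurable I := measurable_segment 0 T.
have mf_ k i : measurable_fun I (fun t : lebesgueR R => f_ k t 0 i).
  exact/measurable_EFinP/(measurable_int _ (If_ k i)).
have mchi i : measurable_fun I (fun t : lebesgueR R => chi t 0 i).
  apply: (@ae_limit_measurable _ _ _ (leb R) _ (fun k t => f_ k t 0 i)) => //.
    exact: leb_complete.
  by apply: filterS f_chi => t h /h.
suff coord i : \forall t \ae leb R, I t -> f t 0 i = chi t 0 i.
  have : \forall t \ae leb R, forall i, I t -> f t 0 i = chi t 0 i.
    exact: filter_forall.
  by apply: filterS => t h It; apply/rowP => i; exact: h.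
suff : ae_eq (leb R) I (fun t => (f t 0 i)%:E) (fun t => (chi t 0 i)%:E).
  by apply: filterS => t h /h[].
apply: (integral_ae_eq mI (If i)); first exact/measurable_EFinP.
move=> E EI mE.
have [ichi _ cvg_int] : [/\ (leb R).-integrable E (fun t => (chi t 0 i)%:E),
    ([sequence \int[leb R]_(t in E) `|(f_ k t 0 i)%:E - (chi t 0 i)%:E| ]_k
      @ \oo --> 0)%E &
    ([sequence \int[leb R]_(t in E) (f_ k t 0 i)%:E]_k @ \oo -->
      \int[leb R]_(t in E) (chi t 0 i)%:E)%E].
  apply: (@dominated_convergence _ _ _ _ _ mE _ _ (fun t => (G t)%:E)).
  - by move=> k; apply/measurable_EFinP; exact: measurable_funS (mf_ k i).
  - by apply/measurable_EFinP; exact: measurable_funS (mchi i).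
  - apply: filterS f_chi => t h /EI/h/(_ i) ft.
    by apply/fine_cvgP; split; [exact: nearW|exact: ft].
  - exact: integrableS IG.
  - by apply: filterS f_G => t h k /EI/h; rewrite lee_fin; apply.
have fin_f : (\int[leb R]_(t in E) (f t 0 i)%:E \is a fin_num)%E.
  by apply: integrable_fin_num => //; apply: integrableS (If i).
have fin_chi := integrable_fin_num mE ichi.
rewrite -(fineK fin_f) -(fineK fin_chi); congr EFin.
have /fine_cvgP[_ lim_chi] : ([sequence \int[leb R]_(t in E) (f_ k t 0 i)%:E]_k
    @ \oo --> (fine (\int[leb R]_(t in E) (chi t 0 i)%:E))%:E)%E.
  by rewrite fineK.
have lim_f := f_f _ (L1_dual_coord_integral i mE EI).
exact: (cvg_unique _ lim_f lim_chi).
Qed.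

End weak_convergence.

Lemma L1_mid (R : realType) (T : R) (n : nat) (f g : R -> 'rV[R]_n) :
  L1 T f -> L1 T g -> L1 T (fun t => 2^-1 *: (f t + g t)).
Proof.
move=> If Ig i; have mI := measurable_segment 0 T.
apply: (eq_integrable mI
  (fun t : lebesgueR R => 2^-1%:E * ((f t 0 i)%:E + (g t 0 i)%:E))%E).
  by move=> t _; rewrite !mxE EFinM EFinD.
exact: integrableZl (integrableD mI (If i) (Ig i)).
Qed.

(** Applied to the midpoint [m] itself, linearity gives
    [L f + L g = L (m + m) = 2 * L m]. *)
Lemma L1_dual_mid (R : realType) (T : R) (n : nat)
    (L : (R -> 'rV[R]_n) -> R) (f g : R -> 'rV[R]_n) :
  L1_dual T L -> L1 T f -> L1 T g ->
  L (fun t => 2^-1 *: (f t + g t)) = 2^-1 * (L f + L g).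
Proof.
move=> [Llin _] If Ig; have Im := L1_mid If Ig.
have := Llin 1 _ _ Im Im; have := Llin 1 _ _ If Ig.
have -> : (fun t => 1 *: (2^-1 *: (f t + g t)) + 2^-1 *: (f t + g t)) =
    (fun t => 1 *: f t + g t).
  apply/funext => t; rewrite !scale1r -scalerDl.
  by rewrite (_ : 2^-1 + 2^-1 = 1 :> R) ?scale1r//; field.
by move=> ->; lra.
Qed.

(** * Jacobians and gradients *)

Lemma jacobianE (R : realType) (n d : nat) (F : 'rV[R]_n -> 'rV[R]_d)
    (x : 'rV[R]_n) (i : 'I_n) (l : 'I_d) :
  differentiable F x -> ('J F x) i l = ('D_(delta_mx 0 i) F x) 0 l.
Proof. by move=> dF; rewrite deriveEjacobian// -rowE [RHS]mxE. Qed.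

Lemma gradient_coord (R : realType) (n d : nat) (F : 'rV[R]_n -> 'rV[R]_d)
    (x : 'rV[R]_n) (l : 'I_d) :
  differentiable F x ->
  gradient (fun y => F y 0 l) x = row l ('J F x)^T.
Proof.
move=> dF; apply/rowP => i; rewrite [LHS]mxE 2![RHS]mxE jacobianE// derive_mx ?mxE//.
exact: diff_derivable.
Qed.

(** Gradients are row vectors, so the combination of the gradients of [h] and
    [g] is a single product of the joint multiplier with the transposed
    Jacobian of [(h, g)]. This is what makes it bilinear in the multiplier and
    the derivative. *)
Lemma multiplier_combinationE (R : realType) (n p m : nat)
    (h : 'rV[R]_n -> R -> 'rV[R]_p) (g : 'rV[R]_n -> R -> 'rV[R]_m)
    (t : R) (x : 'rV[R]_n) (u : 'rV[R]_p) (v : 'rV[R]_m) :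
  differentiable ((hg h g)^~ t) x ->
  \sum_(i < p) u 0 i *: gradient (fun y => h y t 0 i) x
    + \sum_(j < m) v 0 j *: gradient (fun y => g y t 0 j) x
  = row_mx u v *m ('J ((hg h g)^~ t) x)^T.
Proof.
move=> dhg; rewrite mulmx_sum_row big_split_ord.
have hE i : (fun y => h y t 0 i) = (fun y => hg h g y t 0 (lshift m i)).
  by apply/funext => y; rewrite row_mxEl.
have gE j : (fun y => g y t 0 j) = (fun y => hg h g y t 0 (rshift p j)).
  by apply/funext => y; rewrite row_mxEr.
congr (_ + _); apply: eq_bigr => i _.
  by rewrite row_mxEl hE (gradient_coord (lshift m i) dhg).
by rewrite row_mxEr gE (gradient_coord (rshift p i) dhg).
Qed.

Lemma jacobian_cvg (R : realType) (n d : nat) (F : 'rV[R]_n -> 'rV[R]_d)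
    (x : nat -> 'rV[R]_n) (x0 : 'rV[R]_n) :
  continuously_differentiable F -> x k @[k --> \oo] --> x0 ->
  forall i l, ('J F (x k)) i l @[k --> \oo] --> ('J F x0) i l.
Proof.
move=> [dF cF] xx0 i l.
have JE : (fun y => ('J F y) i l) = (fun y => ('D_(delta_mx 0 i) F y) 0 l).
  by apply/funext => y; exact: jacobianE.
have cDF : {for x0, continuous (fun y => 'D_(delta_mx 0 i) F y 0 l)}.
  apply: (@continuous_comp _ _ _ (fun y => 'D_(delta_mx 0 i) F y)
    (fun A : 'rV[R]_d => A 0 l)); first exact: cF.
  exact: coord_continuous.
rewrite -JE in cDF.
exact: (cvg_comp _ _ xx0 cDF).
Qed.

Lemma gminus_cvg (R : realType) (n p m : nat)
    (h : 'rV[R]_n -> R -> 'rV[R]_p) (g : 'rV[R]_n -> R -> 'rV[R]_m)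
    (t : R) (x : nat -> 'rV[R]_n) (x0 : 'rV[R]_n) (j : 'I_m) :
  differentiable ((hg h g)^~ t) x0 -> x k @[k --> \oo] --> x0 ->
  gminus g j (x k) t @[k --> \oo] --> gminus g j x0 t.
Proof.
move=> dF xx0.
have gE y : g y t 0 j = (hg h g) y t 0 (rshift p j) by rewrite /hg row_mxEr.
have cg : {for x0, continuous (fun y => hg h g y t 0 (rshift p j))}.
  apply: (@continuous_comp _ _ _ ((hg h g)^~ t)
    (fun A : 'rV[R]_(p + m) => A 0 (rshift p j))).
    exact: differentiable_continuous.
  exact: coord_continuous.
have gx : g (x k) t 0 j @[k --> \oo] --> g x0 t 0 j.
  by rewrite gE; under eq_fun do rewrite gE; exact: (cvg_comp _ _ xx0 cg).
(* The maximum is expressed by an absolute value, whose continuity is known. *)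
have max0E (a : R) : Num.max (- a) 0 = (- a + `|a|) / 2.
  by rewrite maxr_absE addr0 subr0 normrN.
rewrite /gminus max0E; under eq_fun do rewrite max0E.
apply: cvgM; last exact: cvg_cst.
by apply: cvgD; [exact: cvgN|exact: cvg_norm].
Qed.

Lemma mulmx_coord_bound (R : realType) (n d : nat) (w : 'rV[R]_d)
    (A : 'M[R]_(n, d)) (C c : R) (i : 'I_n) :
  (forall l, `|w 0 l| <= C) -> enorm A <= c ->
  `|(w *m A^T) 0 i| <= (C *+ d) * c.
Proof.
move=> wC Ac; rewrite mxE; apply: (le_trans (ler_norm_sum _ _ _)).
rewrite mulrnAl -[in leRHS](card_ord d) -sumr_const; apply: ler_sum => l _.
by rewrite normrM mxE ler_pM// (le_trans (coord_le_enorm _ _ _) Ac).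
Qed.

(** * Limits of averaged products at a fixed time *)

Lemma mulr_bounded_cvg0 (R : realType) (b e : nat -> R) (C : R) :
  (forall k, `|b k| <= C) -> e k @[k --> \oo] --> 0 ->
  b k * e k @[k --> \oo] --> 0.
Proof.
move=> bC e0; apply/norm_cvg0P.
apply: (@squeeze_cvgr _ _ _ _ (fun=> 0) (fun k => C * `|e k|)).
- by apply: nearW => k; rewrite normr_ge0 normrM ler_wpM2r.
- exact: cvg_cst.
- rewrite -(mulr0 C); apply: cvgM; first exact: cvg_cst.
  exact/norm_cvg0P.
Qed.

Lemma cvg_sumr (R : realType) (n : nat) (f : 'I_n -> nat -> R) (a : 'I_n -> R) :
  (forall i, f i k @[k --> \oo] --> a i) ->
  \sum_i f i k @[k --> \oo] --> \sum_i a i.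
Proof. by move=> fa; apply: cvg_big => [|i _]; [exact: add_continuous|exact: fa]. Qed.

(** Since [w] is bounded, [w k *m (A_ k)^T - w k *m A^T] tends to 0. Its coordinates
    are the values at the pair [(w k, w k *m (A_ k)^T)] of the linear functionals
    [(z1, z2) |-> (z2 - z1 *m A^T) 0 j], so averaging preserves this limit, and
    the averaged multipliers converge by assumption. *)
Lemma tail_hull_mulmx_cvg (R : realType) (n d : nat) (w : nat -> 'rV[R]_d)
    (A_ : nat -> 'M[R]_(n, d)) (A : 'M[R]_(n, d)) (C : R)
    (y : nat -> 'rV[R]_d * 'rV[R]_n) (W : 'rV[R]_d) :
  (forall k l, `|w k 0 l| <= C) ->
  (forall j l, A_ k j l @[k --> \oo] --> A j l) ->
  (forall k, tail_hull (fun k => (w k, w k *m (A_ k)^T)) k (y k)) ->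
  (forall l, (y k).1 0 l @[k --> \oo] --> W 0 l) ->
  forall j, (y k).2 0 j @[k --> \oo] --> (W *m A^T) 0 j.
Proof.
move=> wC A_A hy yW j.
pose residual (z : 'rV[R]_d * 'rV[R]_n) := z.2 0 j - (z.1 *m A^T) 0 j.
have residual0 : residual (y k) @[k --> \oo] --> 0.
  apply: (tail_hull_cvg hy) => [x z _ _|].
    by rewrite /residual /= -scalemxAl mulmxDl !mxE; lra.
  rewrite [X in X @ _ --> _](_ : _ =
      fun k => \sum_l w k 0 l * (A_ k j l - A j l)); last first.
    apply/funext => k; rewrite /residual /= !mxE -sumrB.
    by apply: eq_bigr => l _; rewrite !mxE mulrBr.
  rewrite -[X in _ --> X](@big1_eq R 0 +%R _ (index_enum 'I_d) xpredT).
  apply: cvg_sumr => l; apply: (mulr_bounded_cvg0 (C := C)) => //.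
  rewrite -(subrr (A j l)); apply: cvgB; [exact: A_A|exact: cvg_cst].
have -> : (fun k => (y k).2 0 j) =
    (fun k => residual (y k) + \sum_l (y k).1 0 l * A j l).
  apply/funext => k; rewrite /residual mxE.
  by under eq_bigr do rewrite mxE; rewrite subrK.
rewrite -[X in _ --> X]add0r mxE; under [X in _ --> _ + X]eq_bigr do rewrite mxE.
apply: cvgD => //.
by apply: cvg_sumr => l; apply: cvgM; [exact: yW|exact: cvg_cst].
Qed.

(** Replacing [a_ k] by its limit makes the product linear in the multiplier,
    at the cost of an infinitesimal error, so that averaging preserves its
    limit 0. *)
Lemma complementarity_limit (R : realType) (n d : nat)
    (w : nat -> 'rV[R]_d * 'rV[R]_n) (y : nat -> 'rV[R]_d * 'rV[R]_n)
    (l : 'I_d) (a_ th : nat -> R) (a C W : R) :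
  (forall k, `|(w k).1 0 l| <= C) ->
  (forall k, (w k).1 0 l * a_ k = th k) ->
  a_ k @[k --> \oo] --> a -> th k @[k --> \oo] --> 0 ->
  (forall k, tail_hull w k (y k)) ->
  (y k).1 0 l @[k --> \oo] --> W ->
  W * a = 0.
Proof.
move=> wC wa a_a th0 hy yW.
have lim0 : (y k).1 0 l * a @[k --> \oo] --> 0.
  apply: (tail_hull_cvg (l := fun z : 'rV[R]_d * 'rV[R]_n => z.1 0 l * a) hy)
    => [x z _ _|].
    by rewrite /= !mxE; lra.
  rewrite [X in X @ _ --> _](_ : _ =
      fun k => th k - (w k).1 0 l * (a_ k - a)); last first.
    by apply/funext => k; rewrite mulrBr wa opprB addrC subrK.
  rewrite -[X in _ --> X](subrr 0); apply: cvgB => //.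
  apply: (mulr_bounded_cvg0 (C := C)) => //.
  by rewrite -(subrr a); apply: cvgB => //; exact: cvg_cst.
apply: (cvg_unique _ _ lim0) => //.
by apply: cvgM => //; exact: cvg_cst.
Qed.

(** * Regularity from bounded multipliers *)

Theorem theorem4p1 (R : realType) (T : R) (n p m : nat)
    (phi : 'rV[R]_n -> R -> R)
    (h : 'rV[R]_n -> R -> 'rV[R]_p)
    (g : 'rV[R]_n -> R -> 'rV[R]_m)
    (xbar : R -> 'rV[R]_n) (r : R)
    (T_gt0 : 0 < T)
    (xbar_feasible : feasible T h g xbar)
    (r_gt0 : 0 < r)
    (hyp1 : H1 T phi xbar r)
    (hyp2 : H2 T h g xbar r)
    (bounded_multipliers :
       forall psi : R -> 'rV[R]_n, weak_outer_limit T h g xbar r psi ->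
         exists (x : nat -> R -> 'rV[R]_n) (theta : nat -> R -> 'rV[R]_m)
                (psi_ : nat -> R -> 'rV[R]_n)
                (u : nat -> R -> 'rV[R]_p) (v : nat -> R -> 'rV[R]_m)
                (ku kv : R),
           [/\ representing_sequence T h g xbar r psi x theta psi_ u v,
               0 < ku, 0 < kv &
               ae_time T (fun t => forall k : nat,
                 enorm (u k t) <= ku /\ enorm (v k t) <= kv)]) :
  AKKT_regular T h g xbar r.
Proof.
move=> psi psi_lim; have [psi_L1 _] := psi_lim.
have [x [th [psi_ [u [v [ku [kv [rep ku0 kv0 uv_bound]]]]]]]] :=
  bounded_multipliers _ psi_lim.
have [[xth xth_cvg] [psi_L1_ psi_cvg] uv_Linfty mult] := rep.
have [hg_C1 _ _ [lip [c [_ Ic hg_bound]]]] := hyp2.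
set I := [set` `[0, T]] : set (lebesgueR R).
have mI : measurable I := measurable_segment 0 T.
pose C := ku + kv.
(* Multipliers and [psi_ k] are paired, to be averaged with the same weights. *)
pose w k : (lebesgueR R -> 'rV[R]_(p + m)) * (lebesgueR R -> 'rV[R]_n) :=
  (fun t => row_mx (u k t) (v k t), psi_ k).
have w_bound : ae_time T (fun t => forall k l, `|(w k).1 t 0 l| <= C).
  apply: ae_timeS uv_bound => t uv k l; have [uk vk] := uv k.
  rewrite /=; case: (split_ordP l) => i ->.
    rewrite row_mxEl (le_trans (coord_le_enorm _ _ _))// (le_trans uk)//.
    by rewrite lerDl ltW.
  rewrite row_mxEr (le_trans (coord_le_enorm _ _ _))// (le_trans vk)//.
  by rewrite lerDr ltW.
have w_meas k l : measurable_fun I (fun t => (w k).1 t 0 l).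
  have [[mu_ _] [mv _]] := uv_Linfty k.
  rewrite /=; case: (split_ordP l) => i ->.
    by under eq_fun do rewrite row_mxEl; exact: mu_.
  by under eq_fun do rewrite row_mxEr; exact: mv.
have [y [y_hull y_meas y_cvg]] := bounded_tail_hull_ae_cvg mI
  (leb_segment_lty 0 T) w_meas (fun k => ae_timeS (fun t wt => wt k) w_bound).
pose W (t : R) : 'rV[R]_(p + m) := \row_l limn (fun k => (y k).1 t 0 l).
have y_lim : ae_time T (fun t => forall l, (y k).1 t 0 l @[k --> \oo] --> W t 0 l).
  by apply: ae_timeS y_cvg => t yt l; rewrite mxE; exact: yt.
pose ev t (z : (lebesgueR R -> 'rV[R]_(p + m)) * (lebesgueR R -> 'rV[R]_n)) :=
  (z.1 t, z.2 t).
have ev_hull t k : tail_hull (ev t \o w) k (ev t (y k)).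
  exact: tail_hull_image.
pose good t := [/\ continuously_differentiable ((hg h g)^~ t),
  x k t @[k --> \oo] --> xbar t /\ th k t @[k --> \oo] --> (0 : 'rV[R]_m),
  forall k, psi_ k t = (w k).1 t *m ('J ((hg h g)^~ t) (x k t))^T,
  forall k j, v k t 0 j * gminus g j (x k t) t = th k t 0 j /\ 0 <= v k t 0 j &
  [/\ forall k, enorm ('J ((hg h g)^~ t) (x k t)) <= c t,
      forall k l, `|(w k).1 t 0 l| <= C &
      forall l, (y k).1 t 0 l @[k --> \oo] --> W t 0 l]].
have ae_good : ae_time T good.
  have x_tube : ae_time T (fun t => forall k, tube xbar r t (x k t)).
    by apply: ae_time_foralln => k; have [[_ +] _] := xth k.
  have := ae_timeI (ae_timeI hg_C1 xth_cvg) (ae_timeI (ae_time_foralln mult)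
    (ae_timeI (ae_timeI x_tube hg_bound) (ae_timeI w_bound y_lim))).
  apply: ae_timeS => t [[C1 cv] [mt [[tu [_ bd]] [wb yl]]]].
  split=> //.
  - move=> k; have [-> _] := mt k; apply: multiplier_combinationE; exact: C1.1.
  - by move=> k; have [] := mt k.
  - by split=> // k; apply: bd; exact: ltW (tu k).
have hull_L1 N z : tail_hull w N z -> L1 T z.2.
  elim=> [k _|{}z z' _ Iz _ Iz']; first exact: psi_L1_.
  exact: L1_mid.
have y_L1 k : L1 T (y k).2.
  exact: (hull_L1 _ _ (y_hull k)).
have y_weak : L1_weak_cvg T (fun k => (y k).2) psi.
  move=> L dualL.
  apply: (tail_hull_cvg (l := fun z : _ * (lebesgueR R -> 'rV[R]_n) => L z.2) y_hull).
    by move=> z z' /hull_L1 Iz /hull_L1 Iz'; exact: (L1_dual_mid dualL Iz Iz').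
  exact: psi_cvg.
(* The averaged [psi_ k] are dominated thanks to the bound on the Jacobian;
   their limit is computed at almost every fixed time. *)
have psiE : ae_time T (fun t => psi t = W t *m ('J ((hg h g)^~ t) (xbar t))^T).
  apply: (weak_limit_ae_limit y_L1 psi_L1 y_weak
    (G := fun t => C *+ (p + m) * c t)).
  - exact: (integrableZl mI (C *+ (p + m)) Ic).
  - apply: ae_timeS ae_good => t [_ _ psiE _ [cb wb _]] k i.
    elim: (y_hull k) => [j _|z z' _ Iz _ Iz'].
      by rewrite /= psiE; exact: mulmx_coord_bound.
    by move: Iz Iz'; rewrite /= !mxE !ler_norml; lra.
  - apply: ae_timeS ae_good => t [C1 [xx _] psiE _ [_ wb yl]].
    apply: (@tail_hull_mulmx_cvg _ _ _ (fun k => (w k).1 t)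
      (fun k => 'J ((hg h g)^~ t) (x k t)) _ C (fun k => ev t (y k))) => //.
      exact: jacobian_cvg.
    move=> k; have := ev_hull t k; congr tail_hull.
    by apply/funext => j; rewrite /ev /= psiE.
split=> //; exists (fun t => lsubmx (W t)), (fun t => rsubmx (W t)).
have W_meas l : lebesgue_measurable T (fun t => W t 0 l).
  apply: (@ae_limit_measurable _ _ _ (leb R) _ (fun k t => (y k).1 t 0 l)) => //.
    exact: leb_complete.
  by move: y_lim; rewrite /ae_time; apply: filterS => t yt It; exact: yt.
have W_bound : ae_time T (fun t => forall l, `|W t 0 l| <= C).
  apply: ae_timeS ae_good => t [_ _ _ _ [_ wb yl]] l.
  apply: (cvgr_to_le (cvg_norm (yl l))); apply: nearW => k.
  elim: (y_hull k) => [j _|z z' _ Cz _ Cz']; first exact: wb.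
  by move: Cz Cz'; rewrite /= !mxE !ler_norml; lra.
split.
- apply: (@Linfty_of_coords _ _ _ _ C) => [i|].
    by under eq_fun do rewrite mxE; exact: W_meas.
  by apply: ae_timeS W_bound => t Wt i; rewrite mxE.
- apply: (@Linfty_of_coords _ _ _ _ C) => [i|].
    by under eq_fun do rewrite mxE; exact: W_meas.
  by apply: ae_timeS W_bound => t Wt i; rewrite mxE.
- apply: ae_timeS (ae_timeI psiE ae_good) => t [-> [C1 [xx th0] _ vth [_ wb yl]]].
  split=> [|j].
    by rewrite multiplier_combinationE ?hsubmxK//; exact: C1.1.
  rewrite mxE; split.
    rewrite [RHS]mxE.
    apply: (@complementarity_limit _ _ _ (ev t \o w) (fun k => ev t (y k))
      (rshift p j) (fun k => gminus g j (x k t) t) (fun k => th k t 0 j) _ C) => //.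
    + by move=> k; exact: wb.
    + by move=> k; rewrite /= row_mxEr; have [] := vth k j.
    + exact: (@gminus_cvg _ _ _ _ h g t (fun k => x k t) _ j (C1.1 _) xx).
    + have := cvg_comp _ _ th0 (@coord_continuous R 1 m 0 j (0 : 'rV[R]_m)).
      by rewrite mxE.
  apply: (cvgr_to_ge (yl (rshift p j))); apply: nearW => k.
  elim: (y_hull k) => [i _|z z' _ z0 _ z'0].
    by rewrite /= row_mxEr; have [] := vth i j.
  by rewrite /= !mxE mulr_ge0 ?addr_ge0 ?invr_ge0.
Qed.
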